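(* Let $M\in\mathcal L(\ell^2\otimes\mathcal H^\circ_{\mathbf S},\ell^2\otimes\mathcal H^\circ_{\mathbf R})$ be shift invariant, i.e. $MV_{\mathbf S}=V_{\mathbf R}M$, where $V_{\mathbf R}=V\otimes I_{\mathcal H^\circ_{\mathbf R}}$, $V_{\mathbf S}=V\otimes I_{\mathcal H^\circ_{\mathbf S}}$ and $V:(x_0,x_1,\dots)\mapsto(0,x_0,x_1,\dots)$ is the unilateral shift on $\ell^2$. Assume that the (bounded) inverse $(I-L_{\mathbf G^\circ}(Z)M)^{-1}$ exists for all tuples $Z=(Z_e)_{e\in\mathbf E}$ of operators $Z_e\in\mathcal L(\ell^2)$ such that $\|L_{\mathbf G^\circ}(Z)\|\le1$. Then the collection of all such inverses is uniformly bounded: $$\sup\big\{\|(I-L_{\mathbf G^\circ}(Z)M)^{-1}\|:\ Z=(Z_e)_{e\in\mathbf E},\ Z_e\in\mathcal L(\ell^2),\ \|L_{\mathbf G^\circ}(Z)\|\le1\big\}<\infty .$$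
   Context: All Hilbert spaces are complex; $\mathcal L(\mathcal H,\mathcal K)$ denotes the bounded linear operators from $\mathcal H$ to $\mathcal K$; $\ell^2=\ell^2(\mathbb Z_+)$ is the space of square-summable complex sequences indexed by the nonnegative integers. $G=(\mathbf V,\mathbf E)$ is a finite simple undirected bipartite graph with vertex decomposition $\mathbf V=\mathbf S\sqcup\mathbf R$; each edge $e$ has one endpoint $\mathbf s(e)\in\mathbf S$ and one endpoint $\mathbf r(e)\in\mathbf R$. Each path-connected component of $G$ is a complete bipartite graph (having at least one source vertex, in $\mathbf S$, and at least one range vertex, in $\mathbf R$). $\mathbf P$ is the set of path-connected components and $[v]\in\mathbf P$ is the component containing the vertex $v$. To each $p\in\mathbf P$ a finite-dimensional Hilbert space $\mathcal H_p^\circ$ is assigned; $\mathbf G^\circ=(G,\{\mathcal H_p^\circ\}_{p\in\mathbf P})$. Put $\mathcal H^\circ_{\mathbf S}=\bigoplus_{s\in\mathbf S}\mathcal H^\circ_{[s]}$ and $\mathcal H^\circ_{\mathbf R}=\bigoplus_{r\in\mathbf R}\mathcal H^\circ_{[r]}$. For $s\in\mathbf S$ let $\iota_s:\mathcal H^\circ_{[s]}\to\mathcal H^\circ_{\mathbf S}$ be the embedding as the $s$-th summand, and for $r\in\mathbf R$ let $\iota_r:\mathcal H^\circ_{[r]}\to\mathcal H^\circ_{\mathbf R}$ be the embedding as the $r$-th summand. For a tuple $Z=(Z_e)_{e\in\mathbf E}$ of operators on $\ell^2$ define $$L_{\mathbf G^\circ}(Z)=\sum_{e\in\mathbf E}Z_e\otimes\iota_{\mathbf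 s(e)}\iota_{\mathbf r(e)}^*\ \in\ \mathcal L(\ell^2\otimes\mathcal H^\circ_{\mathbf R},\ell^2\otimes\mathcal H^\circ_{\mathbf S}).$$ *)

(* Defs.v *)
From HB Require Import structures.
From mathcomp Require Import all_boot all_order all_algebra.
From mathcomp Require Import complex.
From mathcomp Require Import all_classical all_reals all_analysis.

Set Implicit Arguments.
Unset Strict Implicit.
Unset Printing Implicit Defensive.

Import Order.TTheory GRing.Theory Num.Theory.

Local Open Scope ring_scope.

(* Inner products are linear in the first argument and conjugate-linear in the
   second. *)
Record finHilbert (R : realType) := FinHilbert {
  hcarrier :> vectType R[i];
  hdot : {dot hcarrier for (@Num.conj R[i])}
}.

Section HilbertNorm.
Variables (R : realType) (H : finHilbert R).

Definition hnorm (v : H) : R := Num.sqrt (complex.Re (hdot H v v)).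

Lemma hdot_ge0 (v : H) : 0 <= hdot H v v.
Proof. exact: dnorm_ge0. Qed.

Lemma Re_ge0 (z : R[i]) : 0 <= z -> 0 <= complex.Re z.
Proof. by rewrite lecE => /andP[_]. Qed.

Lemma Re_le (y z : R[i]) : y <= z -> complex.Re y <= complex.Re z.
Proof. by rewrite lecE => /andP[_]. Qed.

Lemma ReD (y z : R[i]) : complex.Re (y + z) = complex.Re y + complex.Re z.
Proof. by case: y => a b; case: z. Qed.

Lemma ge0_ReM (y z : R[i]) : 0 <= y ->
  complex.Re (y * z) = complex.Re y * complex.Re z.
Proof.
case: y => a b; case: z => c d; rewrite lecE/= => /andP[/eqP -> _].
by rewrite mul0r subr0.
Qed.

Lemma hnorm_ge0 v : 0 <= hnorm v.
Proof. exact: sqrtr_ge0. Qed.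

Lemma hnorm_sqr v : hnorm v ^+ 2 = complex.Re (hdot H v v).
Proof. by rewrite sqr_sqrtr// Re_ge0// hdot_ge0. Qed.

Lemma hnorm0 : hnorm 0 = 0.
Proof. by rewrite /hnorm linear0l sqrtr0. Qed.

Lemma hnormZ_sqr (a : R[i]) v :
  hnorm (a *: v) ^+ 2 = complex.Re (`|a| ^+ 2) * hnorm v ^+ 2.
Proof. by rewrite !hnorm_sqr dnormZ ge0_ReM// exprn_ge0. Qed.

Lemma hnormD_sqr u v :
  hnorm (u + v) ^+ 2 <= 2 * hnorm u ^+ 2 + 2 * hnorm v ^+ 2.
Proof.
rewrite !hnorm_sqr !mulr_natl !mulr2n -!ReD; apply: Re_le.
have := hdot_ge0 (u - v); rewrite dnormB dnormD.
by rewrite subr_ge0 => le_d; rewrite [leRHS]addrACA lerD2l.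
Qed.

Lemma hdot_bound (u v : H) :
  complex.Re (`|hdot H u v| ^+ 2) <= hnorm u ^+ 2 * hnorm v ^+ 2.
Proof.
rewrite !hnorm_sqr -ge0_ReM ?hdot_ge0//; apply: Re_le.
exact: (CauchySchwarz (hdot H) u v).1.
Qed.

Lemma orthonormal_size (n : nat) : (n <= \dim {: H})%N ->
  exists2 s : seq H, orthonormal (hdot H) s & size s = n.
Proof.
elim: n => [_|n IHn lt_n]; first by exists [::].
have [s os ss] := IHn (ltnW lt_n).
have /subvPn[v _ vNs] : ~~ (fullv <= span s)%VS.
  apply/negP => /dimvS; rewrite leqNgt => /negP[].
  by rewrite (leq_ltn_trans (dim_span s))// ss.
have [us ds] : uniq s /\ {in s &, forall x y, hdot H x y = (x == y)%:R}.
  by have /orthonormalP := os.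
pose w := v - \sum_(b <- s) hdot H v b *: b.
have w0 : w != 0.
  rewrite subr_eq0; apply: contra vNs => /eqP ->.
  by rewrite big_seq rpred_sum// => b bs; rewrite rpredZ// memv_span.
have ws b : b \in s -> hdot H w b = 0.
  move=> bs; rewrite linearBl linear_sumlz (bigD1_seq b)//= big1_seq ?addr0.
    by rewrite linearZl_LR/= [hdot H b b]ds// eqxx mulr1 subrr.
  move=> c /andP[cb cs]; by rewrite linearZl_LR/= [hdot H c b]ds// (negbTE cb) mulr0.
pose u := (sqrtC (hdot H w w))^-1 *: w.
have uu : hdot H u u = 1.
  rewrite dnormZ normfV exprVn ger0_norm ?sqrt_dnorm_ge0// sqrtCK mulVf//.
  by rewrite dnorm_eq0.
exists (u :: s); last by rewrite /= ss.
have ub b : b \in s -> hdot H u b = 0.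
  by move=> bs; rewrite linearZl_LR/= (ws b)// mulr0.
apply/orthonormalP; split => [/=|x y].
  rewrite us andbT; apply/negP => /ub; rewrite uu => /eqP.
  by rewrite oner_eq0.
rewrite !inE => /predU1P[->|xs] /predU1P[->|ys]; last exact: ds.
- by rewrite eqxx uu.
- rewrite ub//; case: eqP => // uy; have := ub _ ys; rewrite -uy uu => /eqP.
  by rewrite oner_eq0.
- rewrite hermC /= expr0 mul1r ub// conjC0; case: eqP => // uy.
  by have := ub _ xs; rewrite uy uu => /eqP; rewrite oner_eq0.
Qed.

Lemma onb_exists :
  {s : seq H | orthonormal (hdot H) s & span s = {:H}%VS}.
Proof.
apply: cid2; have [s os ss] := orthonormal_size (leqnn _).
exists s => //; apply/eqP.
rewrite eqEdim subvf /= -ss.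
by have /eqP -> := orthonormal_free os.
Qed.

Definition onb : seq H := s2val onb_exists.

Lemma onb_orthonormal : orthonormal (hdot H) onb.
Proof. exact: (s2valP onb_exists). Qed.

Lemma onb_span : span onb = {:H}%VS.
Proof. exact: (s2valP' onb_exists). Qed.

Lemma onb_expand (v : H) : v = \sum_(b <- onb) hdot H v b *: b.
Proof.
have /orthonormalP[ub db] := onb_orthonormal.
have /(@coord_span _ _ _ (in_tuple onb)) vE : v \in span (in_tuple onb).
  by rewrite /= onb_span memvf.
have cE (i : 'I_(size onb)) : coord (in_tuple onb) i v = hdot H v onb`_i.
  rewrite [in RHS]vE linear_sumlz (bigD1 i)//= big1 ?addr0.
    by rewrite linearZl_LR/= [hdot H _ _]db ?mem_nth// eqxx mulr1.
  move=> j ji; rewrite linearZl_LR/= db ?mem_nth// nth_uniq//.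
  by rewrite (inj_eq val_inj) (negbTE ji) mulr0.
rewrite {1}vE (big_nth 0) big_mkord; apply: eq_bigr => i _.
by rewrite cE.
Qed.

End HilbertNorm.

Section Adjoint.
Variables (R : realType) (H K : finHilbert R) (A : 'Hom(H, K)).

Definition adjoint_fun (k : K) : H := \sum_(b <- onb H) hdot K k (A b) *: b.

Fact adjoint_fun_linear : linear adjoint_fun.
Proof.
move=> a u v; rewrite /adjoint_fun scaler_sumr -big_split/=; apply: eq_bigr => b _.
by rewrite linearDl linearZl_LR/= scalerDl scalerA.
Qed.

HB.instance Definition _ :=
  GRing.isLinear.Build R[i] K H *:%R adjoint_fun adjoint_fun_linear.

Definition adjoint : 'Hom(K, H) := linfun adjoint_fun.

Lemma adjointP (h : H) (k : K) : hdot K (A h) k = hdot H h (adjoint k).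
Proof.
rewrite lfunE/= /adjoint_fun linear_sumr/= {1}(onb_expand h) linear_sum.
rewrite linear_sumlz; apply: eq_bigr => b _.
rewrite linearZ/= linearZl_LR linearZr_LR/= mulrC; congr (_ * _).
by rewrite hermC expr0 mul1r.
Qed.

End Adjoint.

(* The scalar Hilbert space C, with <x, y> = x * conj y. *)
Section ScalarHilbert.
Variable R : realType.

Definition cdot (x y : R[i]^o) : R[i] := x * y^*.

Fact cdot_bilinear : bilinear_for *%R (Num.conj \; *%R) cdot.
Proof.
split=> [y a u v|x a u v] /=; rewrite /cdot.
  by rewrite mulrDl -mulrA.
by rewrite rmorphD rmorphM mulrDr mulrCA.
Qed.

HB.instance Definition _ :=
  bilinear_isBilinear.Build R[i] R[i]^o R[i]^o R[i] *%R (Num.conj \; *%R)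
    cdot cdot_bilinear.

Fact cdot_hermitian (x y : R[i]^o) :
  cdot x y = (-1) ^+ false * Num.conj (cdot y x).
Proof. by rewrite /cdot expr0 mul1r rmorphM/= conjCK mulrC. Qed.

HB.instance Definition _ :=
  isHermitianSesquilinear.Build R[i] R[i]^o false Num.conj cdot cdot_hermitian.

Fact cdot_gt0 (x : R[i]^o) : x != 0 -> 0 < cdot x x.
Proof. by rewrite /cdot mul_conjC_gt0. Qed.

HB.instance Definition _ := isDotProduct.Build R[i] R[i]^o cdot cdot_gt0.

Definition scalarHilbert : finHilbert R := FinHilbert cdot.

End ScalarHilbert.


(* Orthogonal direct sum of a finite family of finite-dimensional Hilbert
   spaces. *)
Section DirectSum.
Variables (R : realType) (I : finType) (H : I -> finHilbert R).

Definition dsum_carrier : Type := {dffun forall i, H i}.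

HB.instance Definition _ := Choice.on dsum_carrier.

Implicit Types x y : dsum_carrier.

Definition dsum_add x y : dsum_carrier := [ffun i => x i + y i].
Definition dsum_opp x : dsum_carrier := [ffun i => - x i].
Definition dsum_zero : dsum_carrier := [ffun i => 0].
Definition dsum_scale (a : R[i]) x : dsum_carrier := [ffun i => a *: x i].

Fact dsum_addA : associative dsum_add.
Proof. by move=> x y z; apply/ffunP => i; rewrite !ffunE addrA. Qed.
Fact dsum_addC : commutative dsum_add.
Proof. by move=> x y; apply/ffunP => i; rewrite !ffunE addrC. Qed.
Fact dsum_add0 : left_id dsum_zero dsum_add.
Proof. by move=> x; apply/ffunP => i; rewrite !ffunE add0r. Qed.
Fact dsum_addN : left_inverse dsum_zero dsum_opp dsum_add.
Proof. by move=> x; apply/ffunP => i; rewrite !ffunE addNr. Qed.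

HB.instance Definition _ := GRing.isZmodule.Build dsum_carrier
  dsum_addA dsum_addC dsum_add0 dsum_addN.

Fact dsum_scaleA a b x : dsum_scale a (dsum_scale b x) = dsum_scale (a * b) x.
Proof. by apply/ffunP => i; rewrite !ffunE scalerA. Qed.
Fact dsum_scale1 : left_id 1 dsum_scale.
Proof. by move=> x; apply/ffunP => i; rewrite !ffunE scale1r. Qed.
Fact dsum_scaleDr : right_distributive dsum_scale +%R.
Proof. by move=> a x y; apply/ffunP => i; rewrite !ffunE scalerDr. Qed.
Fact dsum_scaleDl x : {morph dsum_scale^~ x : a b / a + b}.
Proof. by move=> a b; apply/ffunP => i; rewrite !ffunE scalerDl. Qed.

HB.instance Definition _ := GRing.Zmodule_isLmodule.Build R[i] dsum_carrier
  dsum_scaleA dsum_scale1 dsum_scaleDr dsum_scaleDl.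

Lemma dsum_addE x y i : (x + y) i = x i + y i.
Proof. by rewrite ffunE. Qed.
Lemma dsum_scaleE a x i : (a *: x) i = a *: x i.
Proof. by rewrite ffunE. Qed.
Lemma dsum_zeroE i : (0 : dsum_carrier) i = 0.
Proof. by rewrite ffunE. Qed.

Import VectorInternalTheory.

Let basis_index := {i : I & 'I_(dim (H i))}.

Fact dsum_vect_axiom : Vector.axiom #|{: basis_index}| dsum_carrier.
Proof.
pose f (x : dsum_carrier) : 'rV[R[i]]_#|{: basis_index}| :=
  \row_k v2r (x (tag (enum_val k))) 0 (tagged (enum_val k)).
pose g (v : 'rV[R[i]]_#|{: basis_index}|) : dsum_carrier :=
  [ffun i => r2v (\row_j v 0 (enum_rank (Tagged (fun i => 'I_(dim (H i))) j)))].
exists f.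
  by move=> a x y; apply/rowP => k; rewrite !mxE dsum_addE dsum_scaleE linearP/= !mxE.
exists g => [x|v].
  apply/ffunP => i; rewrite ffunE; apply: (canLR v2rK); apply/rowP => j.
  by rewrite !mxE enum_rankK.
apply/rowP => k; rewrite mxE ffunE r2vK mxE.
transitivity (v 0 (enum_rank (enum_val k))); last by rewrite enum_valK.
by congr (v 0 (enum_rank _)); case: (enum_val k).
Qed.

HB.instance Definition _ :=
  Lmodule_hasFinDim.Build R[i] dsum_carrier dsum_vect_axiom.

Definition dsum_dot (x y : dsum_carrier) : R[i] :=
  \sum_i hdot (H i) (x i) (y i).

Fact dsum_dot_bilinear : bilinear_for *%R (Num.conj \; *%R) dsum_dot.
Proof.
split=> [y a u v|x a u v] /=; rewrite /dsum_dot mulr_sumr -big_split/=;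
  apply: eq_bigr => i _; rewrite dsum_addE dsum_scaleE.
  by rewrite linearDl linearZl_LR.
by rewrite linearPr.
Qed.

HB.instance Definition _ :=
  bilinear_isBilinear.Build R[i] dsum_carrier dsum_carrier R[i]
    *%R (Num.conj \; *%R) dsum_dot dsum_dot_bilinear.

Fact dsum_dot_hermitian x y :
  dsum_dot x y = (-1) ^+ false * Num.conj (dsum_dot y x).
Proof.
rewrite expr0 mul1r rmorph_sum; apply: eq_bigr => i _.
by rewrite hermC expr0 mul1r.
Qed.

HB.instance Definition _ :=
  isHermitianSesquilinear.Build R[i] dsum_carrier false Num.conj
    dsum_dot dsum_dot_hermitian.

Fact dsum_dot_gt0 x : x != 0 -> 0 < dsum_dot x x.
Proof.
move=> x0; rewrite lt_neqAle sumr_ge0 ?andbT; last first.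
  by move=> i _; exact: dnorm_ge0.
apply: contra x0; rewrite eq_sym psumr_eq0 => [/allP /= x0|i _]; last first.
  exact: dnorm_ge0.
apply/eqP/ffunP => i; rewrite ffunE; apply/eqP.
by have := x0 i (mem_index_enum i); rewrite dnorm_eq0.
Qed.

HB.instance Definition _ :=
  isDotProduct.Build R[i] dsum_carrier dsum_dot dsum_dot_gt0.

Definition dsum : finHilbert R := FinHilbert dsum_dot.

Definition embed_fun (i : I) (v : H i) : dsum :=
  [ffun j => eqtype.dfwith (fun j : I => 0 : H j) v j].

Fact embed_fun_linear i : linear (@embed_fun i).
Proof.
move=> a u v; apply/ffunP => j; rewrite dsum_addE dsum_scaleE !ffunE.
case: (eqVneq i j) => [<-|ij]; first by rewrite !eqtype.dfwith_in.
by rewrite !eqtype.dfwith_out// scaler0 addr0.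
Qed.

HB.instance Definition _ i :=
  GRing.isLinear.Build R[i] (H i) dsum *:%R (@embed_fun i)
    (@embed_fun_linear i).

Definition embed (i : I) : 'Hom(H i, dsum) := linfun (@embed_fun i).

Lemma adjoint_embed (i : I) (x : dsum) : adjoint (embed i) x = x i.
Proof.
suff E h : hdot (H i) h (adjoint (embed i) x) = hdot (H i) h (x i).
  set y := adjoint (embed i) x in E *; apply/eqP.
  rewrite -subr_eq0 -(dnorm_eq0 (hdot (H i))) linearBr.
  by rewrite subr_eq0; apply/eqP; exact: E.
rewrite -adjointP lfunE /= /dsum_dot (bigD1 i)//= big1 ?addr0 => [|j ji].
  by rewrite ffunE eqtype.dfwith_in.
by rewrite ffunE eqtype.dfwith_out 1?eq_sym// linear0l.
Qed.

End DirectSum.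

(* [l2 H] is the space of square-summable H-valued sequences indexed by nat,
   i.e. the Hilbert tensor product of l^2 with the finite-dimensional space H:
   the elementary tensor of x and h is the sequence (x_n h)_n. *)
Section SquareSummable.
Variables (R : realType) (H : finHilbert R).
Implicit Types f g : nat -> H.

Definition sqsum f : \bar R := (\sum_(n <oo) (hnorm (f n) ^+ 2)%:E)%E.

Definition square_summable : {pred nat -> H} := fun f => (sqsum f < +oo)%E.

Lemma sqsum_ge0 f : (0 <= sqsum f)%E.
Proof. by apply: nneseries_ge0 => n _ _; rewrite lee_fin sqr_ge0. Qed.

Fact square_summable_submod : submod_closed square_summable.
Proof.
split=> [|a f g f2 g2].
  rewrite unfold_in /sqsum eseries0 ?ltry// => n _ _.
  by rewrite hnorm0 expr0n.
rewrite unfold_in /sqsum.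
pose A := 2 * complex.Re (`|a| ^+ 2).
have A0 : 0 <= A by rewrite mulr_ge0// Re_ge0// exprn_ge0.
apply: (@le_lt_trans _ _ (A%:E * sqsum f + 2%:E * sqsum g)%E).
  rewrite -!nneseriesZl//; try by move=> n _; rewrite lee_fin sqr_ge0.
  rewrite -nneseriesD//; try by move=> n _ _; rewrite mule_ge0// lee_fin sqr_ge0.
  apply: lee_nneseries => [n _ _|n _]; first by rewrite lee_fin sqr_ge0.
  rewrite -!EFinM -EFinD lee_fin (le_trans (hnormD_sqr _ _))//.
  by rewrite hnormZ_sqr mulrA.
by rewrite lte_add_pinfty// lte_mul_pinfty// lee_fin.
Qed.

HB.instance Definition _ := GRing.isSubmodClosed.Build R[i] (nat -> H)
  square_summable square_summable_submod.

Record l2 := L2 { l2_fun :> nat -> H; l2_funP : l2_fun \in square_summable }.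

HB.instance Definition _ := [isSub for l2_fun].
HB.instance Definition _ := [Choice of l2 by <:].
HB.instance Definition _ := [SubChoice_isSubZmodule of l2 by <:].
HB.instance Definition _ := [SubZmodule_isSubLmodule of l2 by <:].

Lemma l2P (x y : l2) : x =1 y -> x = y.
Proof. by move=> xy; apply/val_inj/funext. Qed.

Lemma l2_addE (x y : l2) n : (x + y) n = x n + y n.
Proof. by []. Qed.

Lemma l2_scaleE (a : R[i]) (x : l2) n : (a *: x) n = a *: x n.
Proof. by []. Qed.

Lemma l2_sumE (J : Type) (r : seq J) (F : J -> l2) n :
  (\sum_(j <- r) F j) n = \sum_(j <- r) F j n.
Proof.
by elim/big_ind2 : _ => // x1 y1 x2 y2 <- <-.
Qed.

Definition l2norm (x : l2) : R := Num.sqrt (fine (sqsum x)).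

End SquareSummable.

Section BoundedOperators.
Variable R : realType.
Implicit Types H K : finHilbert R.

Definition opnorm H K (T : l2 H -> l2 K) : \bar R :=
  ereal_sup [set (l2norm (T x))%:E | x in [set x | l2norm x <= 1]].

Record bounded_op H K := BoundedOp {
  bop_fun :> {linear l2 H -> l2 K};
  bop_bounded : (opnorm bop_fun < +oo)%E
}.

Definition is_inverse H (T W : l2 H -> l2 H) := cancel T W /\ cancel W T.

End BoundedOperators.

Section Tensor.
Variables (R : realType).
Local Notation CC := (scalarHilbert R).

Section Elementary.
Variables (H : finHilbert R) (x : l2 CC) (h : H).

Fact etensor_subproof :
  (fun n => (x n : R[i]) *: h) \in @square_summable R H.
Proof.
rewrite unfold_in /sqsum.
under eq_eseriesr do rewrite hnormZ_sqr mulrC EFinM.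
rewrite nneseriesZl; last by move=> n _; rewrite lee_fin Re_ge0// exprn_ge0.
rewrite lte_mul_pinfty ?lee_fin ?sqr_ge0//.
have := l2_funP x; rewrite unfold_in /sqsum.
under eq_eseriesr do rewrite hnorm_sqr /= /cdot -normCK.
by [].
Qed.

Definition etensor : l2 H := L2 etensor_subproof.

End Elementary.

Section Slice.
Variables (H : finHilbert R) (h : H) (f : l2 H).

Fact slice_subproof :
  (fun n => hdot H (f n) h : CC) \in @square_summable R CC.
Proof.
rewrite unfold_in /sqsum.
apply: (@le_lt_trans _ _ ((hnorm h ^+ 2)%:E * sqsum f)%E).
  rewrite -nneseriesZl; last by move=> n _; rewrite lee_fin sqr_ge0.
  apply: lee_nneseries => [n _ _|n _]; first by rewrite lee_fin sqr_ge0.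
  rewrite -EFinM lee_fin hnorm_sqr /= /cdot -normCK mulrC.
  exact: hdot_bound.
by rewrite lte_mul_pinfty ?lee_fin ?sqr_ge0//; exact: l2_funP.
Qed.

(* (I (x) h^* ) f, where h^* = <., h>. *)
Definition slice : l2 CC := L2 slice_subproof.

End Slice.

(* Z (x) A, computed in an orthonormal basis of the finite-dimensional source
   space; [tensorE] characterises it on elementary tensors. *)
Definition tensor (H K : finHilbert R) (Z : bounded_op CC CC)
    (A : 'Hom(H, K)) (f : l2 H) : l2 K :=
  \sum_(b <- onb H) etensor (Z (slice b f)) (A b).

Lemma tensorE (H K : finHilbert R) (Z : bounded_op CC CC) (A : 'Hom(H, K))
  (x : l2 CC) (h : H) : tensor Z A (etensor x h) = etensor (Z x) (A h).
Proof.
apply: l2P => n; rewrite /tensor l2_sumE /= {2}(onb_expand h).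
rewrite linear_sum scaler_sumr; apply: eq_bigr => b _.
rewrite linearZ/= scalerA; congr (_ *: _).
have -> : slice b (etensor x h) = (hdot H h b) *: x.
  by apply: l2P => m /=; rewrite linearZl_LR/= mulrC.
by rewrite linearZ_LR [in RHS]mulrC.
Qed.

Fact tensor_linear (H K : finHilbert R) (Z : bounded_op CC CC)
  (A : 'Hom(H, K)) : linear (tensor Z A).
Proof.
move=> a f g; rewrite /tensor scaler_sumr -big_split/=; apply: eq_bigr => b _.
have -> : slice b (a *: f + g) = a *: slice b f + slice b g.
  by apply: l2P => m /=; rewrite linearPl.
rewrite linearP; apply: l2P => n /=.
by rewrite scalerDl -scalerA.
Qed.

Definition shift_fun (x : l2 CC) (n : nat) : CC :=
  if n is m.+1 then x m else 0.

Lemma sqsum_shift (x : l2 CC) : sqsum (shift_fun x) = sqsum x.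
Proof.
apply/cvg_lim => //; rewrite -cvg_shiftS/=.
under eq_fun do rewrite big_nat_recl//= hnorm0 expr0n add0e.
by apply: is_cvg_nneseries => n _ _; rewrite lee_fin sqr_ge0.
Qed.

Fact shift_subproof (x : l2 CC) : shift_fun x \in @square_summable R CC.
Proof. by rewrite unfold_in sqsum_shift; exact: l2_funP. Qed.

Definition shift_map (x : l2 CC) : l2 CC := L2 (shift_subproof x).

Fact shift_linear : linear shift_map.
Proof.
move=> a x y; apply: l2P => -[|n] //=.
by rewrite -[RHS]/(a *: (0 : CC) + 0) scaler0 addr0.
Qed.

HB.instance Definition _ :=
  GRing.isLinear.Build R[i] (l2 CC) (l2 CC) *:%R shift_map shift_linear.

Fact shift_bounded : (opnorm shift_map < +oo)%E.
Proof.
apply: (@le_lt_trans _ _ 1%E); last exact: ltry.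
apply: ge_ereal_sup => _ [x /= x1 <-].
by rewrite lee_fin /l2norm sqsum_shift.
Qed.

Definition unilateral_shift : bounded_op CC CC := BoundedOp shift_bounded.

End Tensor.

(* A finite simple bipartite graph with source vertices S and range vertices T
   is an adjacency relation between S and T; its vertex set is S + T, and an
   edge is an adjacent pair. *)
Section BipartiteGraph.
Variables (S T : finType) (adj : S -> T -> bool).

Definition graph_rel : rel (S + T) := fun v w =>
  match v, w with
  | inl s, inr t => adj s t
  | inr t, inl s => adj s t
  | _, _ => false
  end.

Lemma graph_rel_sym : symmetric graph_rel.
Proof. by case=> [s|t] [s'|t']. Qed.

Lemma connect_graph_sym : connect_sym graph_rel.
Proof. exact: sym_connect_sym graph_rel_sym. Qed.

Definition component_set (v : S + T) : {set S + T} :=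
  [set w | connect graph_rel v w].

Definition component :=
  {C : {set S + T} | C \in [set component_set v | v : S + T]}.

Fact component_set_in (v : S + T) :
  component_set v \in [set component_set v | v : S + T].
Proof. exact: imset_f. Qed.

Definition component_of (v : S + T) : component :=
  exist _ (component_set v) (component_set_in v).

Definition complete_component (p : component) : Prop :=
  [/\ exists s, inl s \in val p,
      exists t, inr t \in val p &
      forall s t, inl s \in val p -> inr t \in val p -> adj s t].

Definition edge := {st : S * T | adj st.1 st.2}.
Definition edge_source (e : edge) : S := (val e).1.
Definition edge_range (e : edge) : T := (val e).2.

Lemma edge_component (e : edge) :
  component_of (inr (edge_range e)) = component_of (inl (edge_source e)).
Proof.
apply: val_inj; apply/setP => w; rewrite !inE.
apply: (same_connect connect_graph_sym); rewrite connect1//.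
exact: (valP e).
Qed.

End BipartiteGraph.

Section StructuredOperator.
Variables (R : realType) (S T : finType) (adj : S -> T -> bool).
Variable H : component adj -> finHilbert R.

Definition source_space : finHilbert R :=
  dsum (fun s : S => H (component_of adj (inl s))).
Definition range_space : finHilbert R :=
  dsum (fun t : T => H (component_of adj (inr t))).

Definition iota_source (s : S) : 'Hom(H (component_of adj (inl s)), source_space) :=
  embed (fun s : S => H (component_of adj (inl s))) s.
Definition iota_range (t : T) : 'Hom(H (component_of adj (inr t)), range_space) :=
  embed (fun t : T => H (component_of adj (inr t))) t.

(* iota_{s(e)} iota_{r(e)}^*, where the equality [r(e)] = [s(e)] of components
   identifies the domain of iota_{s(e)} with the codomain of iota_{r(e)}^*. *)
Definition edge_hom (e : edge adj) : 'Hom(range_space, source_space) :=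
  (ecast p 'Hom(H p, source_space) (esym (edge_component e))
     (iota_source (edge_source e)) \o adjoint (iota_range (edge_range e)))%VF.

Definition L_G (Z : edge adj -> bounded_op (scalarHilbert R) (scalarHilbert R))
    (f : l2 range_space) : l2 source_space :=
  \sum_(e : edge adj) tensor (Z e) (edge_hom e) f.

End StructuredOperator.

Arguments L_G {R S T adj} H Z f.

(* Main.v *)
(** Suppose the inverses are not uniformly bounded. Then there are contractions
    L(Z_n) and vectors y_n with |y_n|^2 > n and |y_n - L(Z_n) M y_n| <= 1. Choose
    N_n so large that y_n and M y_n have small tails beyond N_n, and cut the
    time axis into consecutive blocks, the n-th of length N_n and starting at
    k_n. Let P_n be the truncation to the first N_n coordinates and Z the
    direct sum over n of P_n Z_n P_n, shifted to the n-th block. Then L(Z) is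
    block diagonal and again a contraction. Since M commutes with the shift V,
    (I - L(Z) M) V^k_n y_n stays bounded while |V^k_n y_n| is unbounded, so
    I - L(Z) M has no bounded inverse. *)

From HB Require Import structures.
Require Import Defs.
From mathcomp Require Import all_boot all_order all_algebra.
From mathcomp Require Import complex.
From mathcomp Require Import all_classical all_reals all_analysis.
From mathcomp Require Import lra.

Set Implicit Arguments.
Unset Strict Implicit.
Unset Printing Implicit Defensive.

Import Order.TTheory GRing.Theory Num.Theory.
Local Open Scope classical_set_scope.
Local Open Scope ring_scope.

(** * Squared norms, partial sums and truncations of square-summable sequences *)

Section SquareNorm.
Variables (R : realType) (H : finHilbert R).
Implicit Types (f : nat -> H) (x y : l2 H).

Definition psum f n : R := \sum_(0 <= m < n) hnorm (f m) ^+ 2.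

Definition l2sqr x : R := fine (sqsum x).

Lemma psum_ge0 f n : 0 <= psum f n.
Proof. by apply: sumr_ge0 => m _; exact: sqr_ge0. Qed.

Lemma le_psum f m n : (m <= n)%N -> psum f m <= psum f n.
Proof.
move=> mn; rewrite /psum (@big_cat_nat _ _ _ m 0 n)//= lerDl.
by apply: sumr_ge0 => i _; exact: sqr_ge0.
Qed.

Lemma psum_addn f k n :
  psum f (k + n) = psum f k + \sum_(0 <= i < n) hnorm (f (k + i)%N) ^+ 2.
Proof.
rewrite /psum (@big_cat_nat _ _ _ k 0 (k + n))//= ?leq_addr//; congr (_ + _).
by rewrite -{1}[k]add0n big_addn addKn; apply: eq_bigr => i _; rewrite addnC.
Qed.

Lemma psum_le_sqsum f n : ((psum f n)%:E <= sqsum f)%E.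
Proof.
rewrite /psum -sumEFin /sqsum; apply: nneseries_lim_ge => m _ _.
by rewrite lee_fin sqr_ge0.
Qed.

Lemma sqsum_le f (c : R) : (forall n, psum f n <= c) -> (sqsum f <= c%:E)%E.
Proof.
move=> fc; apply: lime_le.
  by apply: is_cvg_nneseries => n _ _; rewrite lee_fin sqr_ge0.
by apply: nearW => n; rewrite sumEFin lee_fin; exact: fc.
Qed.

Lemma square_summableP f (c : R) :
  (forall n, psum f n <= c) -> f \in @square_summable R H.
Proof.
by move=> fc; rewrite unfold_in (le_lt_trans (sqsum_le fc))// ltry.
Qed.

Lemma sqsum_fin x : (l2sqr x)%:E = sqsum x.
Proof.
rewrite fineK// ge0_fin_numE ?sqsum_ge0//; have := l2_funP x.
by rewrite unfold_in.
Qed.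

Lemma l2sqr_ge0 x : 0 <= l2sqr x.
Proof. by rewrite fine_ge0// sqsum_ge0. Qed.

Lemma psum_le x n : psum x n <= l2sqr x.
Proof. by rewrite -lee_fin sqsum_fin psum_le_sqsum. Qed.

Lemma l2sqr_le x (c : R) : (forall n, psum x n <= c) -> l2sqr x <= c.
Proof. by move=> xc; rewrite -lee_fin sqsum_fin sqsum_le. Qed.

Lemma l2normE x : l2norm x = Num.sqrt (l2sqr x).
Proof. by []. Qed.

Lemma psum_gt x (e : R) : 0 < e -> exists n, l2sqr x - e < psum x n.
Proof.
move=> e0; apply: contrapT => /forallNP h.
have : l2sqr x <= l2sqr x - e by apply: l2sqr_le => n; rewrite leNgt; exact/negP.
by rewrite leNgt ltrBlDr ltrDl e0.
Qed.

Lemma l2sqr_eq0 x : l2sqr x = 0 -> x = 0.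
Proof.
move=> x0; apply: l2P => n; apply/eqP; rewrite -(dnorm_eq0 (hdot H)).
have : hnorm (x n) ^+ 2 <= 0.
  rewrite -x0 (le_trans _ (psum_le x n.+1))// /psum big_nat_recr//= lerDr.
  exact: psum_ge0.
rewrite hnorm_sqr => h; have := hdot_ge0 (x n); rewrite lecE => /andP[/eqP im re].
by apply/eqP/eqP; rewrite eq_complex im eqxx andbT eq_le h re.
Qed.

Lemma l2sqr0 : l2sqr 0 = 0.
Proof.
apply/eqP; rewrite eq_le l2sqr_ge0 andbT; apply: l2sqr_le => n.
by rewrite /psum big1// => i _; rewrite hnorm0 expr0n.
Qed.

(** The parallelogram law in each coordinate. This crude form of the triangle inequality avoids
    square roots and suffices where only boundedness matters. *)
Lemma l2sqrD x y : l2sqr (x + y) <= 2 * l2sqr x + 2 * l2sqr y.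
Proof.
apply: l2sqr_le => n; apply: (@le_trans _ _ (2 * psum x n + 2 * psum y n)).
  rewrite /psum !mulr_sumr -big_split/=; apply: ler_sum => i _.
  exact: hnormD_sqr.
by apply: lerD; apply: ler_wpM2l => //; exact: psum_le.
Qed.

Lemma l2sqrZ (a : R[i]) x : l2sqr (a *: x) <= complex.Re (`|a| ^+ 2) * l2sqr x.
Proof.
apply: l2sqr_le => n; apply: (@le_trans _ _ (complex.Re (`|a| ^+ 2) * psum x n)).
  by rewrite /psum mulr_sumr; apply: ler_sum => i _; rewrite hnormZ_sqr.
by apply: ler_wpM2l; [exact/Re_ge0/exprn_ge0|exact: psum_le].
Qed.

Lemma l2sqrB x y : l2sqr (x - y) <= 2 * l2sqr x + 2 * l2sqr y.
Proof.
apply: (le_trans (l2sqrD _ _)); rewrite lerD2l ler_pM2l//.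
by rewrite -scaleN1r (le_trans (l2sqrZ _ _))// normrN1 expr1n mul1r.
Qed.

Fact window_subproof (k N : nat) x :
  (fun i => if (i < N)%N then x (k + i)%N else 0) \in @square_summable R H.
Proof.
apply: (@square_summableP _ (l2sqr x)) => n.
apply: (@le_trans _ _ (\sum_(0 <= i < n) hnorm (x (k + i)%N) ^+ 2)).
  apply: ler_sum => i _; case: ifP => // _.
  by rewrite hnorm0 expr0n sqr_ge0.
apply: (le_trans _ (psum_le x (k + n))).
by rewrite psum_addn lerDr psum_ge0.
Qed.

(** The [k]-fold backward shift followed by truncation; for [k = 0] it is the truncation [P_n] of
    the proof idea. *)
Definition window k N x : l2 H := L2 (window_subproof k N x).

Lemma psum_window k N x n : (N <= n)%N ->
  psum (window k N x) n = \sum_(0 <= i < N) hnorm (x (k + i)%N) ^+ 2.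
Proof.
move=> Nn; rewrite /psum (@big_cat_nat _ _ _ N 0 n)//= [X in _ + X]big_nat_cond.
rewrite [X in _ + X]big1 ?addr0 => [|i /andP[/andP[Ni _] _]]; last first.
  by rewrite ltnNge Ni/= hnorm0 expr0n.
by rewrite !big_mkord; apply: eq_bigr => i _; rewrite ltn_ord.
Qed.

Lemma l2sqr_window k N x :
  l2sqr (window k N x) = \sum_(0 <= i < N) hnorm (x (k + i)%N) ^+ 2.
Proof.
apply/eqP; rewrite eq_le -{2}(psum_window k x (leqnn N)) psum_le andbT.
apply: l2sqr_le => n; have [Nn|/ltnW nN] := leqP N n; first by rewrite psum_window.
by rewrite (le_trans (le_psum _ nN))// psum_window.
Qed.

Lemma l2sqr_window0 N x : l2sqr (window 0 N x) <= l2sqr x.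
Proof. by rewrite l2sqr_window; exact: psum_le. Qed.

Lemma windowD k N x y : window k N (x + y) = window k N x + window k N y.
Proof.
by apply: l2P => i; rewrite l2_addE /=; case: ifP; rewrite ?addr0.
Qed.

Lemma windowZ k N a x : window k N (a *: x) = a *: window k N x.
Proof. by apply: l2P => i; rewrite l2_scaleE /=; case: ifP; rewrite ?scaler0. Qed.

Lemma window_linear k N : linear (window k N).
Proof. by move=> a x y; rewrite windowD windowZ. Qed.

Lemma tailE N x i : (x - window 0 N x) i = if (i < N)%N then 0 else x i.
Proof.
rewrite -[LHS]/(x i - (if (i < N)%N then x i else 0)).
by case: ifP; rewrite ?subrr ?subr0.
Qed.

Lemma l2sqr_tail (e : R) x : 0 < e ->
  exists N0, forall N, (N0 <= N)%N -> l2sqr (x - window 0 N x) <= e.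
Proof.
move=> e0; have [N0 xN0] := psum_gt x e0; exists N0 => N N0N.
(* Beyond [N], partial sums of the tail are differences of partial sums of [x]; these are at most
   [e] because [psum x N0] already exceeds [l2sqr x - e]. *)
suff h n : (N <= n)%N -> psum (x - window 0 N x) n = psum x n - psum x N.
  have hn n : (N <= n)%N -> psum (x - window 0 N x) n <= e.
    move=> Nn; rewrite h// lerBlDr (le_trans (psum_le _ _))// -lerBlDl ltW//.
    by rewrite (lt_le_trans xN0)// le_psum.
  apply: l2sqr_le => n; have [/hn//|/ltnW nN] := leqP N n.
  by rewrite (le_trans (le_psum _ nN))// hn.
move=> Nn; rewrite /psum; under eq_bigr do rewrite tailE.
rewrite !(@big_cat_nat _ _ _ N 0 n)//= [in RHS]addrAC subrr add0r.
rewrite [X in X + _]big_nat [X in X + _]big1 ?add0r => [|i /andP[_ ->]].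
  by rewrite !big_nat; apply: eq_bigr => i /andP[Ni _]; rewrite ltnNge Ni.
by rewrite hnorm0 expr0n.
Qed.

End SquareNorm.

(** * Operator norm bounds expressed through squared norms *)

Section OperatorNorm.
Variables (R : realType) (H K : finHilbert R).

Lemma opnorm_le (T : l2 H -> l2 K) (c : R) : 0 <= c ->
  (forall x, l2sqr (T x) <= c ^+ 2 * l2sqr x) -> (opnorm T <= c%:E)%E.
Proof.
move=> c0 Tc; apply: ge_ereal_sup => _ [x /= x1 <-]; rewrite lee_fin.
rewrite -(ger0_norm c0) -sqrtr_sqr l2normE ler_wsqrtr// (le_trans (Tc x))//.
rewrite ler_piMr ?sqr_ge0//.
by rewrite -(@ler_sqrt _ _ 1)// sqrtr1.
Qed.

(** Rescaling to a unit vector. Only homogeneity is asked for, so that the lemma applies to [L_G],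
    which is a plain function. *)
Lemma opnorm_bound (T : l2 H -> l2 K) (c : R) : scalable T ->
  (opnorm T <= c%:E)%E -> forall x, l2sqr (T x) <= c ^+ 2 * l2sqr x.
Proof.
move=> TZ Tc x; have [/l2sqr_eq0 ->|x0] := eqVneq (l2sqr x) 0.
  have := TZ 0 0; rewrite !scale0r => ->.
  by rewrite !l2sqr0 mulr0.
have xgt0 : 0 < l2sqr x by rewrite lt_neqAle eq_sym x0 l2sqr_ge0.
pose r := Num.sqrt (l2sqr x); have r0 : 0 < r by rewrite sqrtr_gt0.
have rr : r ^+ 2 = l2sqr x by rewrite sqr_sqrtr ?ltW.
have ReC (t : R) : complex.Re (`|t%:C%C| ^+ 2 : R[i]) = t ^+ 2.
  by rewrite normCK /= mul0r subr0 expr2.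
pose y := (r^-1)%:C%C *: x.
have y1 : l2norm y <= 1.
  rewrite l2normE -[leRHS]sqrtr1 ler_wsqrtr// (le_trans (l2sqrZ _ _))//.
  by rewrite ReC -rr exprVn mulVf// expf_neq0// gt_eqF.
have Ty : l2sqr (T y) <= c ^+ 2.
  have : ((l2norm (T y))%:E <= c%:E)%E.
    by apply: le_trans Tc; apply: ereal_sup_ubound; exists y.
  rewrite lee_fin l2normE => h; rewrite -[leLHS]sqr_sqrtr ?l2sqr_ge0//.
  by rewrite lerXn2r ?nnegrE ?sqrtr_ge0 ?(le_trans (sqrtr_ge0 _) h).
have -> : T x = r%:C%C *: T y.
  rewrite -TZ /y scalerA -rmorphM/= mulfV ?scale1r//.
  by rewrite gt_eqF.
by rewrite (le_trans (l2sqrZ _ _))// ReC rr mulrC ler_wpM2r ?l2sqr_ge0.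
Qed.

Lemma bounded_opP (T : bounded_op H K) :
  exists2 c : R, 0 <= c & forall x, l2sqr (T x) <= c * l2sqr x.
Proof.
have := bop_bounded T; case: (opnorm T) (@opnorm_bound T) => [c|//|] h _.
  exists (c ^+ 2); first exact: sqr_ge0.
  by apply: h => // a x; rewrite linearZ.
(* Formal case where the supremum is [-oo]: it lies below 0, so the constant 0 works. *)
exists (0 ^+ 2); first exact: sqr_ge0.
by apply: h => [a x|]; rewrite ?linearZ// leNye.
Qed.

End OperatorNorm.

(** * The shift [V] tensored with the identity, and its powers *)

Section Shift.
Variables (R : realType) (H : finHilbert R).
Implicit Type x : l2 H.

Definition l2shift (x : l2 H) : l2 H := tensor (unilateral_shift R) \1%VF x.

Lemma shiftE x m : l2shift x m = if m is m'.+1 then x m' else 0.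
Proof.
rewrite /l2shift /tensor l2_sumE; case: m => [|m] /=.
  by rewrite big1// => b _; rewrite scale0r.
by rewrite [RHS]onb_expand; apply: eq_bigr => b _; rewrite id_lfunE.
Qed.

Lemma iter_shiftE k x m :
  iter k l2shift x m = if (m < k)%N then 0 else x (m - k)%N.
Proof.
elim: k m => [|k IHk] [|m] //=.
  by rewrite shiftE.
by rewrite shiftE IHk.
Qed.

Lemma l2sqr_iter_shift k x : l2sqr (iter k l2shift x) = l2sqr x.
Proof.
have h n : psum (iter k l2shift x) (k + n) = psum x n.
  rewrite psum_addn [X in X + _]big_nat [X in X + _]big1 ?add0r => [|i /andP[_ ik]].
    by apply: eq_bigr => i _; rewrite iter_shiftE ltnNge leq_addr/= addKn.
  by rewrite iter_shiftE ik hnorm0 expr0n.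
apply/eqP; rewrite eq_le; apply/andP; split; apply: l2sqr_le => n.
  by rewrite (le_trans (le_psum _ (leq_addl k n)))// h psum_le.
by rewrite -h psum_le.
Qed.

Lemma iter_shiftB k x y :
  iter k l2shift (x - y) = iter k l2shift x - iter k l2shift y.
Proof.
apply: l2P => m; rewrite iter_shiftE.
rewrite -[RHS]/(iter k l2shift x m - iter k l2shift y m) !iter_shiftE.
by case: ifP => _; rewrite ?subr0.
Qed.

End Shift.

(** * Consecutive blocks of the time axis and block-diagonal gluing *)

Section Blocks.
Variables (N : nat -> nat) (N_gt0 : forall n, (0 < N n)%N).

Definition block_start n := (\sum_(i < n) N i)%N.

Lemma block_startS n : block_start n.+1 = (block_start n + N n)%N.
Proof. by rewrite /block_start big_ord_recr. Qed.

Lemma leq_block_start m n : (m <= n)%N -> (block_start m <= block_start n)%N.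
Proof.
move=> mn; rewrite -(subnKC mn); elim: (n - m)%N => [|i IHi]; first by rewrite addn0.
by rewrite addnS block_startS (leq_trans IHi)// leq_addr.
Qed.

(** Blocks are nonempty, so the first [m.+1] of them use up more than [m] coordinates; hence the
    blocks cover the time axis and [block_of] is total. *)
Lemma ltn_block_start m : exists n, (m < block_start n.+1)%N.
Proof.
exists m; elim: m => [|m IHm]; first by rewrite block_startS ltn_addl.
by rewrite block_startS (leq_ltn_trans IHm)// -[ltnLHS]addn0 ltn_add2l.
Qed.

Definition block_of m := ex_minn (ltn_block_start m).

Lemma block_of_lt m : (m < block_start (block_of m).+1)%N.
Proof. by rewrite /block_of; case: ex_minnP. Qed.

Lemma block_of_ge m : (block_start (block_of m) <= m)%N.
Proof.
rewrite /block_of; case: ex_minnP => -[|n] _ min_n; first by rewrite /block_start big_ord0.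
by rewrite leqNgt; apply/negP => /min_n; rewrite ltnn.
Qed.

Lemma block_of_eq n m :
  (block_start n <= m)%N -> (m < block_start n.+1)%N -> block_of m = n.
Proof.
move=> nm mn; apply/eqP; rewrite eqn_leq; apply/andP; split.
  by rewrite /block_of; case: ex_minnP => b _; apply.
rewrite leqNgt; apply/negP => /leq_block_start.
by rewrite leqNgt (leq_ltn_trans nm (block_of_lt m)).
Qed.

Lemma block_of_start n i : (i < N n)%N -> block_of (block_start n + i) = n.
Proof.
move=> iN; apply: block_of_eq; first exact: leq_addr.
by rewrite block_startS ltn_add2l.
Qed.

Lemma leq_id_block_start n : (n <= block_start n)%N.
Proof.
elim: n => [//|n IHn]; rewrite block_startS (leq_ltn_trans IHn)//.
by rewrite -[ltnLHS]addn0 ltn_add2l.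
Qed.

Lemma psum_blocks (R : realType) (H K : finHilbert R) (f : nat -> H)
    (g : nat -> K) (C : R) :
  (forall n, \sum_(0 <= i < N n) hnorm (g (block_start n + i)%N) ^+ 2 <=
     C * \sum_(0 <= i < N n) hnorm (f (block_start n + i)%N) ^+ 2) ->
  forall n, psum g (block_start n) <= C * psum f (block_start n).
Proof.
move=> fg; elim=> [|n IHn]; first by rewrite /block_start big_ord0 /psum !big_geq// mulr0.
by rewrite block_startS !psum_addn mulrDr lerD.
Qed.

Section Glue.
Variables (R : realType) (H K : finHilbert R).

(** The direct sum of the compressions [P_n T_n P_n], the [n]-th one acting on the [n]-th block.
    Since [T n] may be any map, the formula serves both for the entries of a tuple and for the
    operators [L_G]. *)
Definition glue_fun (T : nat -> l2 H -> l2 K) (x : l2 H) (m : nat) : K :=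
  let n := block_of m in
  T n (window (block_start n) (N n) x) (m - block_start n)%N.

(** Inputs are read from disjoint blocks and outputs are written to the same blocks, so squared
    norms add up and a common bound survives without loss. In particular contractions glue to a
    contraction. *)
Lemma psum_glue (T : nat -> l2 H -> l2 K) (C : R) (x : l2 H) :
  0 <= C -> (forall n y, l2sqr (T n y) <= C * l2sqr y) ->
  forall m, psum (glue_fun T x) m <= C * l2sqr x.
Proof.
(* Enlarge the partial sum to end at a block boundary, where the blockwise estimates can be
   summed. *)
move=> C0 TC m; apply: (le_trans (le_psum _ (leq_id_block_start m))).
apply: (@le_trans _ _ (C * psum x (block_start m))); last first.
  by rewrite ler_wpM2l// psum_le.
apply: psum_blocks => n; rewrite -l2sqr_window (le_trans _ (TC n _))//.
rewrite (le_trans _ (psum_le _ (N n)))// /psum !big_nat.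
apply: ler_sum => i /andP[_ iN]; rewrite /glue_fun block_of_start// addKn.
exact: lexx.
Qed.

Variables (T : nat -> bounded_op H K) (C : R) (C_ge0 : 0 <= C)
  (TC : forall n y, l2sqr (T n y) <= C * l2sqr y).

Definition glue_map (x : l2 H) : l2 K :=
  L2 (square_summableP (psum_glue x C_ge0 TC)).

Fact glue_linear : linear glue_map.
Proof.
move=> a x y; apply: l2P => m; rewrite l2_addE l2_scaleE /= /glue_fun.
by rewrite window_linear linearP.
Qed.

HB.instance Definition _ :=
  GRing.isLinear.Build R[i] (l2 H) (l2 K) *:%R glue_map glue_linear.

Lemma l2sqr_glue x : l2sqr (glue_map x) <= C * l2sqr x.
Proof. by apply: l2sqr_le => n; exact: psum_glue. Qed.

Fact glue_bounded : (opnorm glue_map < +oo)%E.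
Proof.
apply: (@le_lt_trans _ _ (Num.sqrt C)%:E); last exact: ltry.
apply: opnorm_le => [|x]; first exact: sqrtr_ge0.
by rewrite sqr_sqrtr// l2sqr_glue.
Qed.

Definition glue : bounded_op H K := BoundedOp glue_bounded.

End Glue.
End Blocks.

(** * The operators [L_G]: locality of edges, recovery of entries, gluing of tuples *)

Section StructuredOperators.
Variables (R : realType) (S T : finType) (adj : S -> T -> bool).
Variable H : component adj -> finHilbert R.
Local Notation CC := (scalarHilbert R).
Implicit Types (Z : edge adj -> bounded_op CC CC) (e : edge adj).

Lemma L_G_linear Z : linear (L_G H Z).
Proof.
move=> a x y; rewrite /L_G scaler_sumr -big_split/=.
by apply: eq_bigr => e _; rewrite tensor_linear.
Qed.

Lemma L_GD Z x y : L_G H Z (x + y) = L_G H Z x + L_G H Z y.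
Proof. by have := L_G_linear Z 1 x y; rewrite !scale1r. Qed.

Lemma L_G0 Z : L_G H Z 0 = 0.
Proof. by apply: (addIr (L_G H Z 0)); rewrite -L_GD !add0r. Qed.

Lemma L_GZ Z a x : L_G H Z (a *: x) = a *: L_G H Z x.
Proof. by have := L_G_linear Z a x 0; rewrite L_G0 !addr0. Qed.

Lemma L_GB Z x y : L_G H Z (x - y) = L_G H Z x - L_G H Z y.
Proof. by rewrite -scaleN1r addrC L_G_linear scaleN1r addrC. Qed.

Lemma l2sqr_L_G Z x : (opnorm (L_G H Z) <= 1)%E ->
  l2sqr (L_G H Z x) <= l2sqr x.
Proof.
move=> Z1; rewrite -[leRHS]mul1r -(expr1n R 2).
exact: opnorm_bound (L_GZ Z) Z1 x.
Qed.

(** Removes the transport inside [edge_hom]. The preimage [w] may stay unspecified, since it is used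
    only to see that values lie in the range of [iota_source]. *)
Lemma ecast_Hom (K : finHilbert R) (p q : component adj) (pq : p = q)
    (A : 'Hom(H p, K)) (v : H q) :
  exists w, (ecast r 'Hom(H r, K) pq A) v = A w.
Proof. by case: q / pq v => v; exists v. Qed.

Lemma edge_hom_out e (v : range_space H) s : s != edge_source e ->
  (edge_hom H e v : source_space H) s = 0.
Proof.
move=> se; rewrite /edge_hom comp_lfunE.
have [w ->] := ecast_Hom (esym (edge_component e)) (iota_source H (edge_source e))
  (adjoint (iota_range H (edge_range e)) v).
by rewrite /iota_source /embed lfunE /= ffunE eqtype.dfwith_out// eq_sym.
Qed.

Lemma edge_hom0 e (v : range_space H) : v (edge_range e) = 0 -> edge_hom H e v = 0.
Proof.
by move=> v0; rewrite /edge_hom comp_lfunE /iota_range adjoint_embed v0 linear0.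
Qed.

(** Provides the test vector for [edge_bound]. Cutting any [v] outside the kernel down to its
    coordinate at the range vertex does not change its image, because [edge_hom] reads only that
    coordinate; the image lives only at the source vertex. *)
Lemma edge_hom_supp e : edge_hom H e != 0 -> exists v : range_space H,
  (edge_hom H e v : source_space H) (edge_source e) != 0 /\
  forall t, t != edge_range e -> v t = 0.
Proof.
move=> e0; have [v ev] : exists v, edge_hom H e v != 0.
  apply: contrapT => /forallNP h; move/eqP: e0; apply; apply/lfunP => v.
  by rewrite zero_lfunE; apply/eqP/negbNE/negP; exact: h.
pose v' : range_space H := embed _ (edge_range e) (v (edge_range e)).
have v't t : t != edge_range e -> v' t = 0.
  by move=> te; rewrite /v' lfunE /= ffunE eqtype.dfwith_out// eq_sym.
have v'e : v' (edge_range e) = v (edge_range e).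
  by rewrite /v' lfunE /= ffunE eqtype.dfwith_in.
exists v'; split => //.
have <- : edge_hom H e v = edge_hom H e v'.
  apply/eqP; rewrite -subr_eq0 -linearB; apply/eqP/edge_hom0.
  by rewrite -scaleN1r dsum_addE dsum_scaleE v'e scaleN1r subrr.
apply: contra ev => /eqP ev; apply/eqP/ffunP => s; rewrite dsum_zeroE.
by have [->|/edge_hom_out //] := eqVneq s (edge_source e).
Qed.

Lemma hnorm_coord (I : finType) (K : I -> finHilbert R) (v : dsum K) i :
  hnorm (v i) ^+ 2 <= hnorm v ^+ 2.
Proof.
rewrite !hnorm_sqr; apply: Re_le; rewrite /= /dsum_dot (bigD1 i)//= lerDl.
by apply: sumr_ge0 => j _; exact: hdot_ge0.
Qed.

Lemma hnorm_scalar (a : CC) : hnorm a ^+ 2 = complex.Re (`|a : R[i]| ^+ 2).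
Proof. by rewrite hnorm_sqr /= /cdot -normCK. Qed.

Lemma edge_eqP (e e' : edge adj) : edge_source e = edge_source e' ->
  edge_range e = edge_range e' -> e = e'.
Proof.
case: e e' => -[s t] st [[s' t'] st'] /= ss' tt'; apply: val_inj => /=.
by congr (_, _).
Qed.

(* Testing L_G(Z) on x (x) v, with v supported at the range vertex of e, isolates
   Z_e x at the source vertex of e.  When edge_hom e = 0 (a zero component space)
   the contraction hypothesis says nothing about Z_e. *)
Lemma edge_bound e : edge_hom H e != 0 -> exists2 C : R, 0 <= C &
  forall Z, (opnorm (L_G H Z) <= 1)%E -> forall x, l2sqr (Z e x) <= C * l2sqr x.
Proof.
case/edge_hom_supp => v [c0 vt]; set c := (edge_hom H e v : source_space H) _ in c0.
have nc0 : 0 < hnorm c ^+ 2.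
  rewrite lt_neqAle sqr_ge0 andbT eq_sym hnorm_sqr.
  apply: contra c0 => /eqP re; have := hdot_ge0 c; rewrite lecE => /andP[/eqP im _].
  by rewrite -(dnorm_eq0 (hdot (H _))) eq_complex re im eqxx.
(* The constant results from [|Z_e x|^2 |c|^2 <= |L(Z)(x (x) v)|^2 <= |x|^2 |v|^2], whose first
   inequality keeps only the source coordinate of [e]. *)
exists (hnorm v ^+ 2 / hnorm c ^+ 2) => [|Z Z1 x].
  by rewrite divr_ge0// sqr_ge0.
rewrite mulrAC ler_pdivlMr//.
apply: (@le_trans _ _ (l2sqr (etensor x v))); last first.
  apply: l2sqr_le => n; apply: (@le_trans _ _ (hnorm v ^+ 2 * psum x n)); last first.
    by rewrite ler_wpM2l ?sqr_ge0 ?psum_le.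
  rewrite /psum mulr_sumr; apply: ler_sum => i _ /=.
  by rewrite hnormZ_sqr mulrC -hnorm_scalar.
apply: le_trans (l2sqr_L_G _ Z1).
have LE n : (L_G H Z (etensor x v) n : source_space H) (edge_source e) =
    (Z e x n : R[i]) *: c.
  rewrite /L_G l2_sumE.
  have -> (F : edge adj -> source_space H) s : (\sum_e F e) s = \sum_e F e s.
    by elim/big_ind2 : _ => [|u1 u2 w1 w2 <- <-|//]; rewrite ?dsum_zeroE ?dsum_addE.
  rewrite (bigD1 e)//= big1 ?addr0 => [|e' e'e].
    by rewrite tensorE /= dsum_scaleE.
  rewrite tensorE /= dsum_scaleE.
  (* Another edge either ends at a different source vertex and misses this coordinate, or, the graph
     being simple, has a different range vertex, where [v] vanishes. *)
  have [se|se] := eqVneq (edge_source e) (edge_source e'); last first.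
    by rewrite edge_hom_out// scaler0.
  rewrite edge_hom0 ?dsum_zeroE ?scaler0//; apply: vt.
  by apply: contra e'e => /eqP te; apply/eqP/edge_eqP.
rewrite -ler_pdivlMr//; apply: l2sqr_le => n; rewrite ler_pdivlMr//.
apply: le_trans (psum_le _ n); rewrite /psum mulr_suml; apply: ler_sum => i _.
apply: le_trans (hnorm_coord _ (edge_source e)).
by rewrite LE hnormZ_sqr -hnorm_scalar.
Qed.

Lemma slice_window (K : finHilbert R) (h : K) k N x :
  slice h (window k N x) = window k N (slice h x).
Proof. by apply: l2P => i /=; case: ifP => // _; rewrite linear0l. Qed.

Section GlueTuple.
Variables (N : nat -> nat) (N_gt0 : forall n, (0 < N n)%N).
Variable Zs : nat -> edge adj -> bounded_op CC CC.
Hypothesis Zs1 : forall n, (opnorm (L_G H (Zs n)) <= 1)%E.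

(** Slicing commutes with windows, so gluing the entries edge by edge glues the whole operator. The
    bound from [edge_bound] is uniform in [n], which makes each glued entry bounded. *)
Lemma L_G_glue : exists Z, forall x,
  L_G H Z x =1 glue_fun N_gt0 (fun n => L_G H (Zs n)) x.
Proof.
have /choice[Z ZE] e : exists Ze : bounded_op CC CC, edge_hom H e != 0 ->
    forall x, Ze x =1 glue_fun N_gt0 (fun n => Zs n e) x.
  have [e0|/edge_bound[C C0 ZC]] := eqVneq (edge_hom H e) 0.
    (* An arbitrary choice: this entry is multiplied by the zero map. *)
    by exists (unilateral_shift R).
  by exists (glue N_gt0 C0 (fun n y => ZC _ (Zs1 n) y)).
exists Z => x m; rewrite /glue_fun /L_G !l2_sumE; apply: eq_bigr => e _.
rewrite /tensor !l2_sumE; apply: eq_bigr => b _ /=.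
have [->|e0] := eqVneq (edge_hom H e) 0; first by rewrite zero_lfunE !scaler0.
by rewrite ZE// /glue_fun slice_window.
Qed.

End GlueTuple.

End StructuredOperators.

(** * Contradiction from unbounded inverses *)

Lemma opnorm_gt (R : realType) (H K : finHilbert R) (T : l2 H -> l2 K) (a : R) :
  ((Num.sqrt a)%:E < opnorm T)%E -> exists x, l2sqr x <= 1 /\ a < l2sqr (T x).
Proof.
move=> aT; apply: contrapT => h; move: aT; rewrite ltNge => /negP; apply.
apply: ge_ereal_sup => _ [x /= x1 <-]; rewrite lee_fin l2normE ler_wsqrtr//.
rewrite leNgt; apply/negP => aTx; apply: h; exists x; split=> //.
by rewrite -(@ler_sqrt _ _ 1)// sqrtr1.
Qed.

(** A vector truncated to length [N n] and moved to the start of block [n] fits inside that block,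
    and distinct blocks are disjoint. *)
Lemma window_shift (R : realType) (H : finHilbert R) (N : nat -> nat)
    (N_gt0 : forall n, (0 < N n)%N) n m (x : l2 H) :
  window (block_start N m) (N m)
    (iter (block_start N n) (@l2shift R H) (window 0 (N n) x)) =
  if m == n then window 0 (N n) x else 0.
Proof.
apply: l2P => i /=; rewrite iter_shiftE.
case: (eqVneq m n) => [->|mn] /=.
  by case: ifP => // iN; rewrite ltnNge leq_addr/= addKn iN.
case: ifP => // iN; case: ltnP => // ni /=; case: ifP => // iNn.
case/eqP: mn; rewrite -(block_of_start N_gt0 iN); apply: block_of_eq => //.
by rewrite block_startS -ltn_subLR.
Qed.

Theorem lemma4p3 (R : realType)
    (S T : finType) (adj : S -> T -> bool)
    (hG : forall p : component adj, complete_component p)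
    (H : component adj -> finHilbert R)
    (M : bounded_op (source_space H) (range_space H))
    (hM : forall f : l2 (source_space H),
       M (tensor (unilateral_shift R) \1%VF f) = tensor (unilateral_shift R) \1%VF (M f))
    (hinv : forall Z : edge adj -> bounded_op (scalarHilbert R) (scalarHilbert R),
       (opnorm (L_G H Z) <= 1)%E ->
       exists W : bounded_op (source_space H) (source_space H),
         is_inverse (fun f => (f - L_G H Z (M f))%R) W) :
  (ereal_sup
     [set opnorm W | W in
        [set W : bounded_op (source_space H) (source_space H) |
           exists Z : edge adj -> bounded_op (scalarHilbert R) (scalarHilbert R),
             (opnorm (L_G H Z) <= 1)%E /\
             is_inverse (fun f => (f - L_G H Z (M f))%R) W]]
   < +oo)%E.
Proof.
apply: contrapT => sup_oo.
(* y n is the image of a vector of the unit ball under an inverse of norm > sqrt n. *)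
have /choice[yZ yZP] n : exists yZ : l2 (source_space H) *
    (edge adj -> bounded_op (scalarHilbert R) (scalarHilbert R)),
    [/\ (opnorm (L_G H yZ.2) <= 1)%E, n%:R < l2sqr yZ.1 &
        l2sqr (yZ.1 - L_G H yZ.2 (M yZ.1)) <= 1].
  apply: contrapT => /forallNP h; apply: sup_oo.
  apply: (@le_lt_trans _ _ (Num.sqrt n%:R)%:E); last exact: ltry.
  apply: ge_ereal_sup => _ [W /= [Z [Z1 [_ KW]]] <-].
  rewrite leNgt; apply/negP => /opnorm_gt[x [x1 nx]].
  by apply: (h (W x, Z)); split => //=; rewrite KW.
pose y n := (yZ n).1; pose Zs n := (yZ n).2.
have Zs1 n : (opnorm (L_G H (Zs n)) <= 1)%E by have [] := yZP n.
have y_gt n : n%:R < l2sqr (y n) by have [] := yZP n.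
have y_le n : l2sqr (y n - L_G H (Zs n) (M (y n))) <= 1 by have [] := yZP n.
have /choice[N NP] n : exists N, [/\ (0 < N)%N,
    l2sqr (y n - window 0 N (y n)) <= 1 &
    l2sqr (M (y n) - window 0 N (M (y n))) <= 1].
  have [N1 N1P] := l2sqr_tail (y n) ltr01.
  have [N2 N2P] := l2sqr_tail (M (y n)) ltr01.
  (* The successor keeps the block nonempty. *)
  exists (maxn N1 N2).+1; split => //; [apply: N1P|apply: N2P].
    by rewrite leqW// leq_maxl.
  by rewrite leqW// leq_maxr.
have N_gt0 n : (0 < N n)%N by have [] := NP n.
have [Z ZE] := L_G_glue N_gt0 Zs1.
have Z1 : (opnorm (L_G H Z) <= 1)%E.
  apply: opnorm_le => // x; rewrite expr1n; apply: l2sqr_le => m.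
  rewrite /psum; under eq_bigr do rewrite ZE.
  apply: (psum_glue N_gt0) => // n z; rewrite mul1r; exact: l2sqr_L_G.
have [W [KW _]] := hinv Z Z1.
have [C C0 WC] := bounded_opP W.
(* Chosen so that [C * 22 < n]: the argument yields [l2sqr (y n) <= C * 22], against
   [n%:R < l2sqr (y n)]. *)
pose n := (Num.truncn (C * 22)).+1.
set k := block_start N n; set u := M (y n).
set F := iter k (@l2shift R _) (y n).
have MF : M F = iter k (@l2shift R _) u.
  by rewrite /F /u; elim: k {F} => //= k IHk; rewrite /l2shift hM IHk.
(* On a vector living in block [n], the glued operator acts as the compression of [L_G H (Zs n)];
   all other windows see 0. *)
have Lu : L_G H Z (iter k (@l2shift R _) (window 0 (N n) u)) =
    iter k (@l2shift R _) (window 0 (N n) (L_G H (Zs n) (window 0 (N n) u))).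
  apply: l2P => m; rewrite ZE /glue_fun window_shift// iter_shiftE.
  have [mn|mn] := eqVneq (block_of N_gt0 m) n.
    have km : (k <= m)%N by rewrite /k -mn block_of_ge.
    have mk : (m < k + N n)%N by rewrite -block_startS -mn block_of_lt.
    by rewrite mn ltnNge km/= ltn_subLR// mk.
  rewrite L_G0 /=; case: ltnP => // km; case: ifP => // mN.
  case/eqP: mn; apply: block_of_eq => //.
  by rewrite block_startS -ltn_subLR.
(* Every summand on the right has small norm: the tails of y n and M (y n), and
   the nearly annihilated y n - L_G (Zs n) (M (y n)). *)
have FE : F - L_G H Z (M F) =
    iter k (@l2shift R _) ((y n - window 0 (N n) (y n)) +
      window 0 (N n) ((y n - L_G H (Zs n) u) + L_G H (Zs n) (u - window 0 (N n) u)))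
    - L_G H Z (iter k (@l2shift R _) (u - window 0 (N n) u)).
  rewrite L_GB addrA subrK.
  have windowB v w : window 0 (N n) (v - w) =
      window 0 (N n) v - window 0 (N n) w :> l2 (source_space H).
    by rewrite -scaleN1r windowD windowZ scaleN1r.
  rewrite windowB addrA subrK iter_shiftB -Lu [in RHS]iter_shiftB L_GB MF.
  by rewrite opprB addrA subrK.
(* With [p], [q], [r] below of squared norm at most 1, [q + r] contributes at most 4, adding [p]
   gives [2 + 2 * 4 = 10], and the last term gives [2 * 10 + 2 = 22]. *)
have F22 : l2sqr (F - L_G H Z (M F)) <= 22.
  have [_ y1 u1] := NP n.
  rewrite FE; apply: (le_trans (l2sqrB _ _)); rewrite l2sqr_iter_shift.
  have := l2sqr_L_G (iter k (@l2shift R _) (u - window 0 (N n) u)) Z1.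
  rewrite l2sqr_iter_shift => le1.
  set p := y n - window 0 (N n) (y n) in y1 *.
  set q := y n - _; set r := L_G H (Zs n) _.
  have r1 : l2sqr r <= 1 by rewrite (le_trans (l2sqr_L_G _ (Zs1 n))).
  have q1 : l2sqr q <= 1 by exact: y_le.
  have := l2sqrD p (window 0 (N n) (q + r)).
  have := l2sqr_window0 (N n) (q + r).
  have := l2sqrD q r.
  rewrite -/u in u1; lra.
have : l2sqr F <= C * 22.
  (* [F] is recovered by applying [W] to [F - L_G H Z (M F)]. *)
  by rewrite -[F]KW (le_trans (WC _))// ler_wpM2l.
rewrite l2sqr_iter_shift leNgt => /negP; apply.
apply: lt_trans (y_gt n); exact: truncnS_gt.
Qed.
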